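(* Let $n$ and $p$ be integers with $n \geq 1$ and $p \geq 0$, let $S_p(n) = \sum_{k=1}^n k^p$, and let $B_k$ denote the $k$th Bernoulli number with the convention $B_1 = \frac{1}{2}$. Then the following hold. (i) If $p = 0$, then $S_0(n) = n$. (ii) If $p \geq 1$, then $$S_p(n) = \begin{cases} \displaystyle \frac{1}{p+1} \sum_{k=0}^{p/2} \binom{p+1}{2k+1} (n+1)^{2k+1} B_{p-2k} - \frac{(n+1)^p}{2}, & \text{if } p \text{ is even}, \\[2ex] \displaystyle \frac{1}{p+1} \sum_{k=1}^{(p+1)/2} \binom{p+1}{2k} (n+1)^{2k} B_{p-2k+1} - \frac{(n+1)^p}{2}, & \text{if } p \text{ is odd}. \end{cases}$$ (iii) For all $p \geq 0$, $$S_p(n) = \frac{1}{p+1} \sum_{k=0}^{p} \binom{p+1}{k} n^{p-k+1} B_k.$$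
   Context: The Bernoulli numbers $B_k$ ($k \geq 0$), with the convention $B_1 = \frac{1}{2}$, are defined by the generating function $\frac{t e^t}{e^t - 1} = \sum_{k=0}^\infty \frac{B_k t^k}{k!}$; thus $B_0 = 1$, $B_1 = \frac12$, $B_2 = \frac16$, and $B_k = 0$ for odd $k \geq 3$. They agree with the numbers defined by $\frac{t}{e^t-1}$ except at $k=1$. *)

(* Defs.v *)
From Stdlib Require Import Reals Lra Lia Arith Factorial.
From Coquelicot Require Import Coquelicot.
Open Scope R_scope.

(** [B] is the sequence of Bernoulli numbers with [B 1 = 1/2]: the expansion
    is required on a punctured neighbourhood of [0], because at [t = 0] the
    quotient below is [0 * / 0 = 0] instead of its limit [1]. *)
Definition is_bernoulli (B : nat -> R) : Prop :=
  exists r : R, 0 < r /\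
    forall t : R, 0 < Rabs t < r ->
      is_pseries (fun k => B k / INR (fact k)) t (t * exp t / (exp t - 1)).

Definition power_sum (p n : nat) : R :=
  sum_n_m (fun k => INR k ^ p) 1 n.

(** The rest of this file shows that [is_bernoulli] is inhabited.  The series
    [sum_n inv_coef n * t^n] is the inverse of [(exp t - 1) / t]. *)
Definition expm1_coef (n : nat) : R := / INR (fact (S n)).

Fixpoint inv_coef_upto (n : nat) : nat -> R :=
  match n with
  | O => fun _ => 1
  | S n' => fun m =>
      if m <=? n' then inv_coef_upto n' m
      else - sum_f_R0 (fun i => inv_coef_upto n' i * expm1_coef (S n' - i)) n'
  end.

Definition inv_coef (n : nat) : R := inv_coef_upto n n.

Lemma inv_coef_upto_stable (n m : nat) :
  (m <= n)%nat -> inv_coef_upto n m = inv_coef m.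
Proof.
induction n as [|n IH]; intros H.
- now replace m with O by lia.
- destruct (Nat.eq_dec m (S n)) as [->|Hm]; [reflexivity|].
  cbn [inv_coef_upto]. rewrite (proj2 (Nat.leb_le m n)) by lia. apply IH; lia.
Qed.

Lemma inv_coef_S (n : nat) :
  inv_coef (S n) =
  - sum_f_R0 (fun i => inv_coef i * expm1_coef (S n - i)) n.
Proof.
unfold inv_coef at 1. cbn [inv_coef_upto].
rewrite (proj2 (Nat.leb_gt (S n) n)) by lia.
f_equal. apply sum_eq. intros i Hi. now rewrite inv_coef_upto_stable.
Qed.

Lemma inv_coef_mult (n : nat) :
  PS_mult inv_coef expm1_coef n = if n =? 0 then 1 else 0.
Proof.
destruct n as [|n]; unfold PS_mult.
- simpl. unfold inv_coef, expm1_coef. simpl. field.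
- rewrite tech5, inv_coef_S, Nat.sub_diag.
  unfold expm1_coef at 3. simpl. field.
Qed.

Lemma expm1_coef_bound (n : nat) : 0 < expm1_coef n <= (/ 2) ^ n.
Proof.
unfold expm1_coef. split.
- apply Rinv_0_lt_compat, INR_fact_lt_0.
- rewrite pow_inv. apply Rinv_le_contravar; [apply pow_lt; lra|].
  induction n as [|n IH]; [simpl; lra|].
  change (fact (S (S n))) with (S (S n) * fact (S n))%nat.
  rewrite mult_INR. change (2 ^ S n) with (2 * 2 ^ n).
  assert (H2 : 2 <= INR (S (S n))) by (change 2 with (INR 2); apply le_INR; lia).
  assert (0 < 2 ^ n) by (apply pow_lt; lra).
  apply Rmult_le_compat; lra.
Qed.

Lemma half_sum_le_1 (n : nat) : sum_f_R0 (fun i => (/ 2) ^ (S n - i)) n <= 1.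
Proof.
induction n as [|n IH]; [simpl; lra|].
rewrite tech5. replace (S (S n) - S n)%nat with 1%nat by lia.
rewrite (sum_eq _ (fun i => (/ 2) ^ (S n - i) * / 2)).
- rewrite <- scal_sum. simpl pow at 2. lra.
- intros i Hi. replace (S (S n) - i)%nat with (S (S n - i)) by lia.
  simpl. ring.
Qed.

Lemma inv_coef_bound (n : nat) : Rabs (inv_coef n) <= 1.
Proof.
induction n as [[|n] IH] using (well_founded_induction lt_wf).
- unfold inv_coef. simpl. rewrite Rabs_R1. lra.
- rewrite inv_coef_S, Rabs_Ropp.
  apply Rle_trans with (2 := half_sum_le_1 n).
  eapply Rle_trans; [apply Rsum_abs|].
  apply sum_Rle. intros i Hi. rewrite Rabs_mult.
  destruct (expm1_coef_bound (S n - i)) as [H1 H2].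
  rewrite (Rabs_pos_eq (expm1_coef _)) by lra.
  assert (Hb := IH i ltac:(lia)). assert (Ha := Rabs_pos (inv_coef i)). nra.
Qed.

Lemma CV_radius_ge_1 (a : nat -> R) (x : R) :
  (forall n, Rabs (a n) <= 1) -> Rabs x < 1 -> Rbar_lt (Rabs x) (CV_radius a).
Proof.
intros Ha Hx. apply Rbar_lt_le_trans with (Finite 1); [exact Hx|].
apply (proj1 (CV_radius_bounded a)). exists 1. intros n.
now rewrite pow1, Rmult_1_r.
Qed.

Lemma is_bernoulli_exists : exists B : nat -> R, is_bernoulli B.
Proof.
set (e := fun n : nat => / INR (fact n)).
assert (He : forall n, Rabs (e n) <= 1).
{ intros n. unfold e.
  rewrite Rabs_pos_eq by (apply Rlt_le, Rinv_0_lt_compat, INR_fact_lt_0).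
  rewrite <- Rinv_1. apply Rinv_le_contravar; [lra|].
  change 1 with (INR 1). apply le_INR. assert (H := lt_O_fact n). lia. }
exists (fun k => INR (fact k) * PS_mult inv_coef e k).
exists 1. split; [lra|]. intros t [Ht0 Ht1].
assert (Ht : t <> 0) by (intros ->; rewrite Rabs_R0 in Ht0; lra).
assert (Hb : Rbar_lt (Rabs t) (CV_radius inv_coef))
  by (apply CV_radius_ge_1; [apply inv_coef_bound|exact Ht1]).
assert (Ha : Rbar_lt (Rabs t) (CV_radius expm1_coef))
  by (apply CV_radius_ge_1; [intros n; apply (He (S n))|exact Ht1]).
assert (HA : PSeries expm1_coef t = (exp t - 1) / t).
{ apply is_pseries_unique.
  assert (H := is_pseries_decr_1 e t (/ t) (exp t)
                 (Rinv_l t Ht) (is_exp_Reals t)).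
  replace ((exp t - 1) / t) with (scal (/ t) (plus (exp t) (opp (e 0%nat)))).
  - exact H.
  - unfold scal, plus, opp, e; simpl. unfold mult; simpl. now field. }
assert (HM : PSeries inv_coef t * PSeries expm1_coef t = 1).
{ rewrite <- PSeries_mult by assumption.
  rewrite (PSeries_ext _ _ t inv_coef_mult).
  rewrite PSeries_decr_1.
  - rewrite (PSeries_ext _ (fun _ => 0)) by reflexivity.
    rewrite PSeries_const_0. simpl. ring.
  - apply CV_radius_inside, CV_radius_ge_1; [|exact Ht1].
    intros [|n]; simpl; rewrite ?Rabs_R1, ?Rabs_R0; lra. }
rewrite HA in HM.
assert (Hexp : exp t - 1 <> 0).
{ intros H0. rewrite H0 in HM. unfold Rdiv in HM.
  rewrite Rmult_0_l, Rmult_0_r in HM. lra. }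
replace (t * exp t / (exp t - 1)) with (PSeries inv_coef t * exp t).
- apply is_pseries_ext with (PS_mult inv_coef e).
  { intros n. simpl. change (PS_mult inv_coef e n = INR (fact n) * PS_mult inv_coef e n / INR (fact n)). field. apply INR_fact_neq_0. }
  apply is_pseries_mult.
  + now apply PSeries_correct, CV_radius_inside.
  + apply is_exp_Reals.
  + exact Hb.
  + now apply CV_radius_ge_1.
- replace (PSeries inv_coef t) with (t / (exp t - 1)).
  + field. exact Hexp.
  + apply Rmult_eq_reg_r with ((exp t - 1) / t).
    * rewrite HM. now field.
    * intros H0. rewrite H0, Rmult_0_r in HM. lra.
Qed.

(* Main.v *)
Require Import Defs.
From Stdlib Require Import Reals Arith.
From Coquelicot Require Import Coquelicot.
From Stdlib Require Import Lra Lia.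
Open Scope R_scope.

(** Write [f t = t * exp t / (exp t - 1)].  Everything comes from two identities
    between functions, read off on power series coefficients at [0].

    The geometric sum gives
    [f t * exp (n t) = f t + t * (exp t + exp (2 t) + ... + exp (n t))].
    The coefficient of [t^m] in the bracket is [power_sum m n / m!], so the
    coefficients of [t^(p+1)] on both sides give the formula in powers of [n],
    for every natural number [n] ([faulhaber]).

    The symmetry [f t = f (- t) + t] shows that [B 1 = 1/2] and that the other
    odd Bernoulli numbers vanish ([bernoulli_1], [bernoulli_odd]).

    For the formulas in powers of [n + 1], [faulhaber] is applied at [n + 1],
    which adds [(n+1)^p] to [power_sum p n].  On the right-hand side the term
    with [B 1] contributes [(n+1)^p / 2], the other odd Bernoulli numbers
    contribute [0], and the even ones, in reverse order, give the sums over
    [k] of the two parity cases ([sum_odd_vanish]).  The difference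
    [(n+1)^p / 2 - (n+1)^p] is the correction term [- (n+1)^p / 2]. *)

(** Big sums are stated in abstract algebraic structures over [R]; [ring] and
    [field] need the equation and its operations at [R] itself. *)
Ltac to_R :=
  change plus with Rplus; change mult with Rmult;
  match goal with |- @eq _ ?u ?v => change (@eq R u v) end.

(** * Power series expansions on a punctured neighbourhood of zero *)

(** The point [0] is left out because the functions of interest are quotients
    by [exp t - 1]. *)
Definition has_expansion (a : nat -> R) (f : R -> R) : Prop :=
  exists r : R, 0 < r /\ forall t : R, 0 < Rabs t < r -> is_pseries a t (f t).

Lemma has_expansion_entire (a : nat -> R) (f : R -> R) :
  (forall t, is_pseries a t (f t)) -> has_expansion a f.
Proof.
intros H. exists 1. split; [lra|]. intros t _. apply H.
Qed.

Lemma has_expansion_ext_coef (a b : nat -> R) (f : R -> R) :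
  (forall k, a k = b k) -> has_expansion a f -> has_expansion b f.
Proof.
intros Hab [r [Hr H]]. exists r. split; [exact Hr|].
intros t Ht. apply is_pseries_ext with a; [exact Hab|]. now apply H.
Qed.

Lemma has_expansion_ext_fun (a : nat -> R) (f g : R -> R) :
  (forall t, t <> 0 -> f t = g t) -> has_expansion a f -> has_expansion a g.
Proof.
intros Hfg [r [Hr H]]. exists r. split; [exact Hr|].
intros t Ht. rewrite <- Hfg; [now apply H|].
intros ->. rewrite Rabs_R0 in Ht. lra.
Qed.

Lemma has_expansion_plus (a b : nat -> R) (f g : R -> R) :
  has_expansion a f -> has_expansion b g ->
  has_expansion (fun k => a k + b k) (fun t => f t + g t).
Proof.
intros [r [Hr Ha]] [s [Hs Hb]]. exists (Rmin r s).
split; [now apply Rmin_glb_lt|]. intros t Ht.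
assert (H1 := Rmin_l r s). assert (H2 := Rmin_r r s).
apply (is_pseries_plus a b t (f t) (g t)); [apply Ha | apply Hb]; lra.
Qed.

Lemma has_expansion_mult_var (a : nat -> R) (f : R -> R) :
  has_expansion a f -> has_expansion (PS_incr_1 a) (fun t => t * f t).
Proof.
intros [r [Hr Ha]]. exists r. split; [exact Hr|].
intros t Ht. now apply (is_pseries_incr_1 a t (f t)), Ha.
Qed.

(** Convergence at a point beyond [t] bounds the radius from below. *)
Lemma CV_radius_gt (a : nat -> R) (f : R -> R) (r t : R) :
  (forall t, 0 < Rabs t < r -> is_pseries a t (f t)) ->
  Rabs t < r -> Rbar_lt (Rabs t) (CV_radius a).
Proof.
intros Ha Ht. assert (H0 := Rabs_pos t). set (s := (Rabs t + r) / 2).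
assert (Hs : Rabs s = s) by (apply Rabs_pos_eq; unfold s; lra).
apply Rbar_lt_le_trans with (Finite s); [simpl; unfold s; lra|].
apply Rbar_not_lt_le. intros Hlt. rewrite <- Hs in Hlt.
apply (CV_disk_outside a s Hlt), ex_series_lim_0.
exists (f s). apply is_series_ext with (fun k => scal (pow_n s k) (a k)).
- intros k. rewrite pow_n_pow. apply Rmult_comm.
- apply Ha. rewrite Hs. unfold s. lra.
Qed.

Lemma has_expansion_mult (a b : nat -> R) (f g : R -> R) :
  has_expansion a f -> has_expansion b g ->
  has_expansion (PS_mult a b) (fun t => f t * g t).
Proof.
intros [r [Hr Ha]] [s [Hs Hb]]. exists (Rmin r s).
split; [now apply Rmin_glb_lt|]. intros t Ht.
assert (H1 := Rmin_l r s). assert (H2 := Rmin_r r s).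
apply is_pseries_mult.
- apply Ha. lra.
- apply Hb. lra.
- apply CV_radius_gt with f r; [exact Ha | lra].
- apply CV_radius_gt with g s; [exact Hb | lra].
Qed.

Lemma is_pseries_scale_var (a : nat -> R) (c t l : R) :
  is_pseries a (c * t) l -> is_pseries (fun k => c ^ k * a k) t l.
Proof.
unfold is_pseries. apply is_series_ext. intros k.
rewrite !pow_n_pow, Rpow_mult_distr.
change (c ^ k * t ^ k * a k = t ^ k * (c ^ k * a k)). ring.
Qed.

Lemma has_expansion_opp_var (a : nat -> R) (f : R -> R) :
  has_expansion a f ->
  has_expansion (fun k => (-1) ^ k * a k) (fun t => f (- t)).
Proof.
intros [r [Hr Ha]]. exists r. split; [exact Hr|]. intros t Ht.
apply is_pseries_scale_var. replace (-1 * t) with (- t) by ring.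
apply Ha. now rewrite Rabs_Ropp.
Qed.

(** The values at [0] may differ a priori; multiplying both series by the
    variable makes them agree there without any appeal to continuity. *)
Lemma has_expansion_unique (a b : nat -> R) (f : R -> R) (n : nat) :
  has_expansion a f -> has_expansion b f -> a n = b n.
Proof.
intros [r [Hr Ha]] [s [Hs Hb]].
assert (Hrad : forall c u, 0 < u ->
  (forall t, 0 < Rabs t < u -> is_pseries c t (f t)) ->
  Rbar_lt 0 (CV_radius (PS_incr_1 c))).
{ intros c u Hu Hc. rewrite CV_radius_incr_1, <- Rabs_R0.
  apply CV_radius_gt with f u; [exact Hc|]. rewrite Rabs_R0. lra. }
apply (PSeries_ext_recip (PS_incr_1 a) (PS_incr_1 b) (S n)).
- now apply Hrad with r.
- now apply Hrad with s.
- assert (Hm : 0 < Rmin r s) by now apply Rmin_glb_lt.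
  exists (mkposreal _ Hm). intros t Ht.
  change (Rabs (t - 0) < Rmin r s) in Ht. rewrite Rminus_0_r in Ht.
  assert (H1 := Rmin_l r s). assert (H2 := Rmin_r r s).
  rewrite !PSeries_incr_1.
  destruct (Req_dec t 0) as [->|H0]; [now rewrite !Rmult_0_l|].
  apply Rabs_pos_lt in H0. f_equal. transitivity (f t).
  + apply is_pseries_unique, Ha. lra.
  + symmetry. apply is_pseries_unique, Hb. lra.
Qed.

(** * Exponential generating functions *)

Lemma exp_scaled_expansion (c : R) :
  has_expansion (fun k => c ^ k / INR (fact k)) (fun t => exp (c * t)).
Proof.
apply has_expansion_entire. intros t.
exact (is_pseries_scale_var _ _ _ _ (is_exp_Reals (c * t))).
Qed.

Lemma exp_minus_1_neq_0 (t : R) : t <> 0 -> exp t - 1 <> 0.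
Proof.
intros Ht H. apply Ht, exp_inv. rewrite exp_0. lra.
Qed.

(** The function is the geometric sum of [exp (k * t)] for [1 <= k <= n]. *)
Lemma power_sum_expansion (n : nat) :
  has_expansion (fun m => power_sum m n / INR (fact m))
    (fun t => exp t * (exp (INR n * t) - 1) / (exp t - 1)).
Proof.
induction n as [|n IH].
- apply has_expansion_ext_fun with (fun _ => 0).
  { intros t Ht. simpl INR. rewrite Rmult_0_l, exp_0. field.
    now apply exp_minus_1_neq_0. }
  apply has_expansion_ext_coef with (fun _ => 0).
  { intros k. unfold power_sum. rewrite sum_n_m_zero by lia.
    change (0 = 0 / INR (fact k)). field. apply INR_fact_neq_0. }
  apply has_expansion_entire. intros t.
  assert (H : is_pseries (fun _ => 0) t (PSeries (fun _ => 0) t)).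
  { apply PSeries_correct, CV_radius_inside. now rewrite CV_radius_const_0. }
  now rewrite PSeries_const_0 in H.
- apply has_expansion_ext_fun with
    (fun t => exp t * (exp (INR n * t) - 1) / (exp t - 1)
              + exp (INR (S n) * t)).
  { intros t Ht. rewrite S_INR, Rmult_plus_distr_r, Rmult_1_l, exp_plus.
    field. now apply exp_minus_1_neq_0. }
  eapply has_expansion_ext_coef;
    [|exact (has_expansion_plus _ _ _ _ IH (exp_scaled_expansion (INR (S n))))].
  intros m. unfold power_sum. rewrite sum_n_Sm by lia.
  cbv beta. change plus with Rplus. field. apply INR_fact_neq_0.
Qed.

(** * Bernoulli numbers *)

(** The coefficient identity of [f t = f (- t) + t], where the coefficients
    of [t] are written as those of [t * exp (0 * t)]. *)
Lemma bernoulli_reflection (B : nat -> R) (k : nat) :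
  is_bernoulli B ->
  B k / INR (fact k) =
  (-1) ^ k * (B k / INR (fact k))
  + PS_incr_1 (fun m => 0 ^ m / INR (fact m)) k.
Proof.
intros HB. change (has_expansion (fun k => B k / INR (fact k))
                     (fun t => t * exp t / (exp t - 1))) in HB.
apply (has_expansion_unique (fun k => B k / INR (fact k))
  (fun k => (-1) ^ k * (B k / INR (fact k))
            + PS_incr_1 (fun m => 0 ^ m / INR (fact m)) k) _ k HB).
eapply has_expansion_ext_fun;
  [|exact (has_expansion_plus _ _ _ _ (has_expansion_opp_var _ _ HB)
             (has_expansion_mult_var _ _ (exp_scaled_expansion 0)))].
intros t Ht. cbv beta. rewrite Rmult_0_l, exp_0, exp_Ropp.
assert (H := exp_minus_1_neq_0 t Ht). assert (He := exp_pos t).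
field. repeat split; lra.
Qed.

Lemma bernoulli_1 (B : nat -> R) : is_bernoulli B -> B 1%nat = / 2.
Proof.
intros HB. assert (H := bernoulli_reflection B 1 HB).
simpl in H. lra.
Qed.

Lemma bernoulli_odd (B : nat -> R) (j : nat) :
  is_bernoulli B -> B (2 * j + 3)%nat = 0.
Proof.
intros HB. assert (H := bernoulli_reflection B (2 * j + 3) HB).
assert (H0 : PS_incr_1 (fun m => 0 ^ m / INR (fact m)) (2 * j + 3) = 0).
{ replace (2 * j + 3)%nat with (S (S (2 * j + 1))) by lia.
  cbn [PS_incr_1 pow]. rewrite Rmult_0_l. apply Rmult_0_l. }
assert (Hsign : (-1) ^ (2 * j + 3) = -1).
{ replace (2 * j + 3)%nat with (S (2 * S j)) by lia. apply pow_1_odd. }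
rewrite H0, Hsign in H.
assert (Hf := INR_fact_neq_0 (2 * j + 3)).
replace (B (2 * j + 3)%nat)
  with (B (2 * j + 3)%nat / INR (fact (2 * j + 3)) * INR (fact (2 * j + 3)))
  by now field.
replace (B (2 * j + 3)%nat / INR (fact (2 * j + 3))) with 0 by lra. ring.
Qed.

(** The coefficients of [t^(p+1)] in
    [f t * exp (n t) = f t + t * (exp t + ... + exp (n t))]; the term of
    index [p + 1] of the product on the left cancels that of [f]. *)
Lemma faulhaber (B : nat -> R) (n p : nat) :
  is_bernoulli B ->
  power_sum p n =
    1 / INR (p + 1) *
      sum_n_m (fun k => Binomial.C (p + 1) k * INR n ^ (p + 1 - k) * B k) 0 p.
Proof.
intros HB. change (has_expansion (fun k => B k / INR (fact k))
                     (fun t => t * exp t / (exp t - 1))) in HB.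
assert (Hcoef :
  PS_mult (fun k => B k / INR (fact k))
    (fun k => INR n ^ k / INR (fact k)) (S p) =
  B (S p) / INR (fact (S p)) + power_sum p n / INR (fact p)).
{ assert (Hr := has_expansion_plus _ _ _ _ HB
            (has_expansion_mult_var _ _ (power_sum_expansion n))).
  apply (fun H => has_expansion_unique _ _ _ (S p) H Hr).
  eapply has_expansion_ext_fun;
    [|exact (has_expansion_mult _ _ _ _ HB (exp_scaled_expansion (INR n)))].
  intros t Ht. cbv beta. field. now apply exp_minus_1_neq_0. }
unfold PS_mult in Hcoef. rewrite tech5, Nat.sub_diag, <- sum_n_Reals in Hcoef.
assert (Hp := INR_fact_neq_0 p).
assert (HSp : INR (S p) <> 0) by now apply not_0_INR.
assert (Hsum : sum_n (fun k => B k / INR (fact k) *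
          (INR n ^ (S p - k) / INR (fact (S p - k)))) p
        = power_sum p n / INR (fact p)) by (simpl in Hcoef |- *; lra).
replace (power_sum p n) with (INR (fact p) * (power_sum p n / INR (fact p)))
  by now field.
rewrite <- Hsum.
etransitivity; [symmetry; apply (sum_n_m_mult_l (INR (fact p)))|].
etransitivity; [|apply (sum_n_m_mult_l (1 / INR (p + 1)))].
apply sum_n_m_ext. intros k.
rewrite Nat.add_1_r. unfold Binomial.C.
rewrite fact_simpl, mult_INR.
assert (Hk := INR_fact_neq_0 k). assert (Hd := INR_fact_neq_0 (S p - k)).
to_R. field. auto.
Qed.

(** * Splitting by parity *)

(** The terms of even index are listed downwards, the order in which the
    powers of [n + 1] increase. *)
Lemma sum_odd_vanish (g : nat -> R) (m : nat) :
  (forall j, g (2 * j + 3)%nat = 0) ->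
  sum_n_m g 0 (2 * m + 1) =
  g 1%nat + sum_n_m (fun j => g (2 * (m - j))%nat) 0 m.
Proof.
intros Hodd. induction m as [|m IH].
- simpl Nat.add. rewrite sum_n_Sm, !sum_n_n by lia. apply Rplus_comm.
- replace (2 * S m + 1)%nat with (S (S (2 * m + 1))) by lia.
  rewrite 2!(sum_n_Sm g), IH by lia.
  replace (S (S (2 * m + 1))) with (2 * m + 3)%nat by lia. rewrite Hodd.
  rewrite (sum_Sn_m _ 0 (S m)), <- sum_n_m_S by lia.
  replace (S (2 * m + 1)) with (2 * (S m - 0))%nat by lia.
  cbn [Nat.sub]. to_R. ring.
Qed.

Theorem theorem2 (B : nat -> R) (HB : is_bernoulli B)
    (n p : nat) (hn : (1 <= n)%nat) :
  (p = 0%nat -> power_sum p n = INR n) /\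
  ((1 <= p)%nat ->
    (Nat.Even p ->
      power_sum p n =
        1 / INR (p + 1) *
          sum_n_m (fun k => Binomial.C (p + 1) (2 * k + 1)
                            * INR (n + 1) ^ (2 * k + 1) * B (p - 2 * k)%nat)
                  0 (p / 2)
        - INR (n + 1) ^ p / 2) /\
    (Nat.Odd p ->
      power_sum p n =
        1 / INR (p + 1) *
          sum_n_m (fun k => Binomial.C (p + 1) (2 * k)
                            * INR (n + 1) ^ (2 * k) * B (p + 1 - 2 * k)%nat)
                  1 ((p + 1) / 2)
        - INR (n + 1) ^ p / 2)) /\
  power_sum p n =
    1 / INR (p + 1) *
      sum_n_m (fun k => Binomial.C (p + 1) k * INR n ^ (p + 1 - k) * B k) 0 p.
Proof.
split; [|split].
- intros ->. change (sum_n_m (fun _ => 1) 1 n = INR n). rewrite sum_n_m_const.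
  replace (S n - 1)%nat with n by lia. apply Rmult_1_r.
- intros Hp.
  set (N := INR (n + 1)).
  set (G := fun k => Binomial.C (p + 1) k * N ^ (p + 1 - k) * B k).
  assert (Hsucc : power_sum p n = 1 / INR (p + 1) * sum_n_m G 0 p - N ^ p).
  { unfold G, N. rewrite <- faulhaber by exact HB.
    unfold power_sum. rewrite Nat.add_1_r, sum_n_Sm by lia.
    to_R. lra. }
  assert (HGodd : forall j, G (2 * j + 3)%nat = 0).
  { intros j. unfold G. rewrite (bernoulli_odd B j HB). ring. }
  assert (HSp : INR (p + 1) <> 0) by (apply not_0_INR; lia).
  assert (HG1 : 1 / INR (p + 1) * G 1%nat = N ^ p / 2).
  { unfold G. rewrite (bernoulli_1 B HB). rewrite Nat.add_sub.
    unfold Binomial.C. rewrite Nat.add_sub.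
    replace (fact (p + 1)) with ((p + 1) * fact p)%nat
      by now rewrite Nat.add_1_r.
    rewrite mult_INR. simpl (fact 1). simpl (INR 1).
    assert (Hf := INR_fact_neq_0 p). field. auto. }
  assert (Hsplit : forall m, sum_n_m G 0 p = sum_n_m G 0 (2 * m + 1) ->
    power_sum p n =
      1 / INR (p + 1) * sum_n_m (fun j => G (2 * (m - j))%nat) 0 m
      - N ^ p / 2).
  { intros m Hm. rewrite Hsucc, Hm, sum_odd_vanish by exact HGodd.
    rewrite Rmult_plus_distr_l, HG1. lra. }
  split.
  + intros [m Hm]. rewrite (Hsplit m).
    * replace (p / 2)%nat with m
        by (rewrite Hm, Nat.mul_comm, Nat.div_mul; lia).
      f_equal. f_equal. apply sum_n_m_ext_loc. intros j Hj. unfold G.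
      rewrite (pascal_step1 (p + 1) (2 * j + 1)) by lia.
      replace (p + 1 - (2 * j + 1))%nat with (2 * (m - j))%nat by lia.
      replace (p + 1 - 2 * (m - j))%nat with (2 * j + 1)%nat by lia.
      now replace (p - 2 * j)%nat with (2 * (m - j))%nat by lia.
    * (* The added term has the odd index [p + 1 >= 3]. *)
      rewrite Nat.add_1_r, <- Hm, sum_n_Sm by lia.
      replace (S p) with (2 * (m - 1) + 3)%nat by lia.
      rewrite HGodd. symmetry. apply Rplus_0_r.
  + intros [m Hm]. rewrite (Hsplit m) by now rewrite Hm.
    replace ((p + 1) / 2)%nat with (S m)
      by (replace (p + 1)%nat with (S m * 2)%nat by lia;
          rewrite Nat.div_mul; lia).
    rewrite <- sum_n_m_S. f_equal. f_equal.
    apply sum_n_m_ext_loc. intros j Hj. unfold G.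
    rewrite (pascal_step1 (p + 1) (2 * S j)) by lia.
    replace (p + 1 - 2 * S j)%nat with (2 * (m - j))%nat by lia.
    now replace (p + 1 - 2 * (m - j))%nat with (2 * S j)%nat by lia.
- now apply faulhaber.
Qed.
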